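(* Let $d\ge2$ be an integer. Then: (i) for all $h\in\mathbb R$, $$\lambda_h>d\,\overline\Phi\Big(h\,\frac{d-1}{\sqrt d}\Big)$$ (in particular $\lambda_0>\frac d2$); (ii) for all $h\ge0$, $$\lambda_h\le\lambda_0\,e^{-\frac{h^2(d-1)^2}{2d}}\quad\Big(<d\,e^{-\frac{h^2(d-1)^2}{2d}}\Big).$$
   Context: $\overline\Phi(a)=\frac1{\sqrt{2\pi}}\int_a^{\infty}e^{-s^2/2}\,ds$. $\nu$ is the centered Gaussian law on $\mathbb R$ with variance $\sigma^2=\frac{d}{d^2-1}$. $L$ is the operator on $L^2(\nu)$ given by $(Lf)(a)=d\,E^Y\big[f\big(\tfrac ad+\sqrt{1-d^{-2}}\,Y\big)\big]$ with $Y$ distributed according to $\nu$. For $h\in\mathbb R$, $\pi_h$ is multiplication by $1_{[h,\infty)}$, $L_h=\pi_hL\pi_h$ (a self-adjoint, non-negative, Hilbert–Schmidt operator on $L^2(\nu)$), and $$\lambda_h=\|L_h\|_{L^2(\nu)\to L^2(\nu)}=\sup\{\langle f,L_hf\rangle_\nu:\ \|f\|_{L^2(\nu)}=1\}.$$ *)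

(* Defs.v *)
From HB Require Import structures.
From mathcomp Require Import all_boot all_order all_algebra.
From mathcomp Require Import all_classical all_reals all_analysis.

Set Implicit Arguments.
Unset Strict Implicit.
Unset Printing Implicit Defensive.
Import Order.TTheory GRing.Theory Num.Theory.
Import numFieldNormedType.Exports.

Local Open Scope classical_set_scope.
Local Open Scope ring_scope.

Definition gauss_tail {R : realType} (a : R) : R :=
  (Num.sqrt (2 * pi))^-1 *
  \int[lebesgue_measure]_(s in `[a, +oo[) expR (- (s ^+ 2 / 2)).

(* The second parameter of [normal_prob] is the standard deviation. *)
Definition nu {R : realType} (d : nat) : probability (measurableTypeR R) R :=
  normal_prob 0 (Num.sqrt (d%:R / (d%:R ^+ 2 - 1))).

(* Operators on L^2 act on representatives.  When 1 < d the law of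
   a / d + sqrt (1 - d^-2) * Y has, for each a, a bounded density with respect
   to [nu d]; hence the expectation is finite for every f in L^2(nu d), and
   depends only on the class of f. *)
Definition L_op {R : realType} (d : nat) (f : R -> R) : R -> R :=
  fun a => d%:R *
    fine 'E_(nu d)[fun y => f (a / d%:R + Num.sqrt (1 - d%:R ^- 2) * y)].

Definition pi_op {R : realType} (h : R) (f : R -> R) : R -> R :=
  fun a => \1_(`[h, +oo[) a * f a.

Definition Lh_op {R : realType} (d : nat) (h : R) (f : R -> R) : R -> R :=
  pi_op h (L_op d (pi_op h f)).

Definition L2_opnorm {R : realType}
    (mu : {measure set (measurableTypeR R) -> \bar R})
    (T : (R -> R) -> (R -> R)) : \bar R :=
  ereal_sup [set ('N[mu]_2%:E[EFin \o T f])%E | f in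
    [set f : R -> R | f \in Lfun mu 2%:E /\ ('N[mu]_2%:E[EFin \o f] <= 1)%E]].

(* [fine] sends +oo to 0, so a positive lower bound on [lambda d h] entails
   that the operator norm is finite. *)
Definition lambda {R : realType} (d : nat) (h : R) : R :=
  fine (L2_opnorm (nu d) (Lh_op d h)).

(* Main.v *)
Require Import Defs.
From HB Require Import structures.
From mathcomp Require Import all_boot all_order all_algebra.
From mathcomp Require Import all_classical all_reals all_analysis.
From mathcomp Require Import measurable_realfun ring lra.
Set Implicit Arguments.
Unset Strict Implicit.
Unset Printing Implicit Defensive.
Import Order.TTheory GRing.Theory Num.Theory.
Import numFieldNormedType.Exports.
Import HBNNSimple.
Local Open Scope classical_set_scope.
Local Open Scope ring_scope.

(** Completing the square turns the operator L into an integral operator with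
respect to nu: (L f)(a) = d * int k(a, y) f(y) dnu(y), where
k(x, y) = d / sqrt (d^2 - 1) * exp (x y - (x^2 + y^2) / (2 d)) is the Mehler
kernel ([integral_mehler]).  It is symmetric, positive and of total mass 1 in
each variable.  As |L_h f| <= L_h |f|, the norm of L_h can be studied on
nonnegative functions, in terms of k restricted to [h, oo) x [h, oo).  The
kernel form makes three arguments possible.

Lower bound ([lambda_gt]).  Apply L_h to the normalised indicator of [h, oo).
Given a, the law of a / d + sqrt (1 - d^-2) Y is normal with mean a / d and
variance 1 / d, so that (L 1_[h, oo))(a) is d times the Gaussian tail at
sqrt d * (h - a / d).  This increases strictly with a and takes at a = h the
value claimed in (i); hence the norm of the image exceeds that value.

Strict upper bound ([lambda0_lt]).  The Schur test ([schur_test]) bounds the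
norm of a symmetric positive kernel by any c for which some positive weight w
satisfies int k(x, y) w(y) dnu(y) <= c w(x).  The constant weight gives
lambda_h <= d.  On [0, oo) the weight C + |x| with a large constant C gives a
constant c < 1: for bounded x mass is lost because the Gaussian step leaves
the half-line with probability bounded below, while for large x the drift
towards 0 contracts |x| by the factor 1 / d <= 1 / 2.

Exponential decay ([lambda_le_exp]).  Translation by h carries [0, oo) onto
[h, oo) and, after multiplication by the square root r_h of the Cameron-Martin
density, is an isometry of L^2(nu).  Conjugating L_h by it yields the kernel
k(h + x, h + y) r_h(x) r_h(y), which equals
k(x, y) exp (- (h^2 + h (x + y)) (d - 1)^2 / (2 d)).  For x, y, h >= 0 this is
at most exp (- h^2 (d - 1)^2 / (2 d)) times the kernel of L_0
([half_line_kernel_shift]), and norms of positive kernels are monotone. *)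

(** * Integration against densities and affine substitution *)

(** Both sides are continuous along increasing sequences, so the identity
passes from indicators to simple functions and then to all nonnegative
measurable functions. *)
Lemma ge0_integral_density d (T : measurableType d) (R : realType)
    (mu nu : {measure set T -> \bar R}) (g : T -> R) (f : T -> \bar R) :
  measurable_fun setT g -> (forall x, 0 <= g x) ->
  (forall A, measurable A -> nu A = (\int[mu]_(x in A) (g x)%:E)%E) ->
  measurable_fun setT f -> (forall x, (0 <= f x)%E) ->
  (\int[nu]_x f x = \int[mu]_x ((g x)%:E * f x))%E.
Proof.
move=> mg g0 nuE mf f0.
pose f_ := nnsfun_approx measurableT mf.
have fE x : f x = limn (fun n => (f_ n x)%:E).
  by apply/esym/cvg_lim => //; apply: cvg_nnsfun_approx => // ? _; exact: f0.
transitivity (limn (fun n => \int[nu]_x (f_ n x)%:E)%E).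
  rewrite -monotone_convergence//.
  - by apply: eq_integral => x _; exact: fE.
  - by move=> n; exact/measurable_EFinP/measurable_funTS.
  - by move=> n x _; rewrite lee_fin.
  - by move=> x _ m n mn; rewrite lee_fin; exact/lefP/nd_nnsfun_approx.
transitivity (limn (fun n => \int[mu]_x ((g x)%:E * (f_ n x)%:E))%E); last first.
  rewrite -monotone_convergence//.
  - apply: eq_integral => x _; apply/cvg_lim => //.
    apply: cvgeZl => //.
    by apply: cvg_nnsfun_approx => // ? _; exact: f0.
  - move=> n; apply: emeasurable_funM; first exact/measurable_EFinP.
    exact/measurable_EFinP/measurable_funTS.
  - by move=> n x _; rewrite -EFinM lee_fin mulr_ge0.
  - move=> x _ m n mn; rewrite -!EFinM lee_fin ler_wpM2l//.
    exact/lefP/nd_nnsfun_approx.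
congr (limn _); apply/funext => n.
under eq_integral do rewrite fimfunE -fsumEFin//.
rewrite ge0_integral_fsum//; last 2 first.
- by move=> y; exact/measurable_EFinP/measurable_funM.
- by move=> y x _; rewrite ?EFinM nnfun_muleindic_ge0.
transitivity (\sum_(k \in range (f_ n))
    (\int[mu]_x ((g x)%:E * (k * \1_(f_ n @^-1` [set k]) x)%:E)))%E.
  apply: eq_fsbigr => r /set_mem [t _ <-]; rewrite integralZl_indic_nnsfun// integral_indic//=.
  rewrite setIT nuE//.
  under [RHS]eq_integral do rewrite EFinM muleCA.
  rewrite ge0_integralZl//=.
  - rewrite integral_mkcond; congr (_ * _)%E; apply: eq_integral => x _.
    rewrite epatch_indic //.
  - by apply/measurable_EFinP; apply: measurable_funM.
  - by move=> x _; rewrite lee_fin mulr_ge0.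
  - by rewrite lee_fin.
rewrite -ge0_integral_fsum//.
- apply: eq_integral => x _; rewrite [in RHS]fimfunE -fsumEFin//.
  by rewrite ge0_mule_fsumr// => r; rewrite ?EFinM nnfun_muleindic_ge0.
- move=> r; apply: emeasurable_funM; first exact/measurable_EFinP.
  exact/measurable_EFinP/measurable_funM.
- move=> r x _; apply: mule_ge0; first by rewrite lee_fin.
  by rewrite EFinM nnfun_muleindic_ge0.
Qed.

(** The image of Lebesgue measure under an increasing affine map, multiplied by
the slope, gives every interval its length, hence is Lebesgue measure.  Unlike
the substitution rules of calculus, this asks no continuity of f. *)
Lemma ge0_integral_affine (R : realType) (m s : R) (f : R -> \bar R) :
  0 < s -> measurable_fun setT f -> (forall x, (0 <= f x)%E) ->
  (\int[lebesgue_measure]_x (s%:E * f (m + s * x)%R) =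
   \int[lebesgue_measure]_x f x)%E.
Proof.
move=> s0 mf f0.
pose phi (x : measurableTypeR R) : measurableTypeR R := m + s * x.
have mphi : measurable_fun setT phi.
  by apply: measurable_funD => //; exact: measurable_funM.
rewrite ge0_integralZl//=; last 2 first.
- exact: (measurableT_comp mf).
- by rewrite lee_fin ltW.
pose P := measure_function_pushforward__canonical__measure_function_Measure
  lebesgue_measure mphi.
transitivity (s%:E * \int[P]_x f x)%E.
  by congr (_ * _)%E; rewrite ge0_integral_pushforward.
pose sn : {nonneg R} := NngNum (ltW s0).
transitivity (\int[mscale sn P]_x f x)%E.
  by rewrite ge0_integral_mscale.
apply: eq_measure_integral => A mA _.
apply/esym; apply: lebesgue_measure_unique => //= X [[a b] _ <-] /=.
rewrite /mscale/= /pushforward.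
have -> : phi @^-1` `]a, b] = [set` `](((a : R) - m) / s)%R, (((b : R) - m) / s)%R]] :> set R.
  apply/seteqP; split => x /=; rewrite !in_itv/= ltr_pdivrMr// ler_pdivlMr// /phi;
    rewrite ltrBlDl lerBrDl (mulrC x) //.
rewrite !lebesgue_measure_itv/= !lte_fin ltr_pM2r ?invr_gt0// ltrD2r.
case: ifP => _; last by rewrite mule0.
rewrite -EFinD -EFinM; congr EFin; field.
by rewrite gt_eqF.
Qed.

(** * L2 norms, the Cauchy-Schwarz inequality and the Schur test *)

(** No measurability is asked of either function: for nonnegative functions
the integral is a supremum over simple minorants.  This spares a measurability
proof for images of general functions under the operators below. *)
Lemma ge0_le_integral_setT d (T : measurableType d) (R : realType)
    (mu : {measure set T -> \bar R}) (f g : T -> \bar R) :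
  (forall x, (0 <= f x)%E) -> (forall x, (f x <= g x)%E) ->
  (\int[mu]_x f x <= \int[mu]_x g x)%E.
Proof.
move=> f0 fg.
have g0 x : (0 <= g x)%E := le_trans (f0 x) (fg x).
rewrite !ge0_integralTE//; apply: le_ereal_sup => _ [h hf <-].
by exists h => // x; exact: le_trans (hf x) (fg x).
Qed.

Lemma poweRe2 (R : realType) (x : \bar R) : (0 <= x)%E -> (x `^ 2 = x * x)%E.
Proof.
case: x => [r r0| |]//=; last by rewrite mulyy pnatr_eq0.
by rewrite -[2]/(2%:R) powR_mulrn// expr2 EFinM.
Qed.

Lemma Lnorm2_sqr d (T : measurableType d) (R : realType)
    (mu : {measure set T -> \bar R}) (f : T -> R) :
  ('N[mu]_2%:E[EFin \o f] * 'N[mu]_2%:E[EFin \o f] =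
   \int[mu]_x (f x ^+ 2)%:E)%E.
Proof.
rewrite -poweRe2 ?Lnorm_ge0// poweR_Lnorm//.
by apply: eq_integral => x _; rewrite poweRe2//= -EFinM -expr2 real_normK ?num_real.
Qed.

Lemma cauchy_schwarz_integral d (T : measurableType d) (R : realType)
    (mu : {measure set T -> \bar R}) (f g : T -> R) :
  measurable_fun setT f -> measurable_fun setT g ->
  (forall x, 0 <= f x * g x) ->
  ((\int[mu]_x (f x * g x)%:E) * (\int[mu]_x (f x * g x)%:E) <=
   (\int[mu]_x (f x ^+ 2)%:E) * \int[mu]_x (g x ^+ 2)%:E)%E.
Proof.
move=> mf mg fg0.
have := @hoelder _ _ _ mu _ _ 2 2 mf mg (ltr0n _ 2) (ltr0n _ 2).
have -> : 2^-1 + 2^-1 = 1 :> R by lra.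
move=> /(_ erefl); rewrite Lnorm1.
under eq_integral do rewrite /= ger0_norm//.
move=> H; rewrite -!Lnorm2_sqr muleACA.
have I0 : (0 <= \int[mu]_x (f x * g x)%:E)%E by apply: integral_ge0 => x _; rewrite lee_fin.
by apply: lee_pmul.
Qed.

(** By the Cauchy-Schwarz inequality applied to
k |f| = sqrt (k w) * (sqrt (k / w) |f|), the square of the inner integral is at
most c w(x) * int k(x, y) f(y)^2 / w(y); integrating in x first (Tonelli) and
using the symmetry of k brings in the hypothesis on w a second time. *)
Lemma schur_test d (T : measurableType d) (R : realType)
    (mu : {sigma_finite_measure set T -> \bar R})
    (k : T -> T -> R) (w f : T -> R) (c : R) :
  measurable_fun setT (fun z : T * T => k z.1 z.2) ->
  measurable_fun setT w -> measurable_fun setT f ->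
  (forall x y, 0 <= k x y) -> (forall x y, k x y = k y x) ->
  (forall x, 0 < w x) -> 0 <= c ->
  (forall x, (\int[mu]_y (k x y * w y)%:E <= (c * w x)%:E)%E) ->
  (\int[mu]_x ((\int[mu]_y (k x y * `|f y|)%:E) *
               (\int[mu]_y (k x y * `|f y|)%:E)) <=
   (c ^+ 2)%:E * \int[mu]_x (f x ^+ 2)%:E)%E.
Proof.
move=> mk mw mf k0 ksym w0 c0 kw.
have mkx x : measurable_fun setT (k x) by exact: (measurable_fun_pair2 x mk).
(* Measurability of the inverse and the square root comes from real powers. *)
have mwV : measurable_fun setT (fun y => (w y)^-1).
  rewrite (_ : (fun _ => _) = (fun y => w y `^ (-1))).
    exact: (measurableT_comp (measurable_powR _)).
  by apply/funext => y; rewrite powR_inv1// ltW.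
have msqrt (h : T -> R) : measurable_fun setT h -> (forall y, 0 <= h y) ->
    measurable_fun setT (fun y => Num.sqrt (h y)).
  move=> mh h0; rewrite (_ : (fun _ => _) = (fun y => h y `^ 2^-1)).
    exact: (measurableT_comp (measurable_powR _)).
  by apply/funext => y; rewrite powR12_sqrt.
pose F (z : T * T) := (c * w z.1 * (k z.1 z.2 * f z.2 ^+ 2 / w z.2))%:E.
have F0 z : (0 <= F z)%E.
  rewrite lee_fin; apply: mulr_ge0; first exact: mulr_ge0 c0 (ltW (w0 _)).
  exact: divr_ge0 (mulr_ge0 (k0 _ _) (sqr_ge0 _)) (ltW (w0 _)).
have step1 x : ((\int[mu]_y (k x y * `|f y|)%:E) *
   (\int[mu]_y (k x y * `|f y|)%:E) <= \int[mu]_y F (x, y))%E.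
  pose u y := Num.sqrt (k x y * w y).
  pose v y := Num.sqrt (k x y / w y) * `|f y|.
  have uv y : u y * v y = k x y * `|f y|.
    rewrite /u /v mulrA -sqrtrM; last exact: mulr_ge0 (k0 _ _) (ltW (w0 _)).
    by rewrite mulrACA (mulfV (lt0r_neq0 (w0 y))) mulr1 -expr2 sqrtr_sqr ger0_norm.
  have -> : (\int[mu]_y (k x y * `|f y|)%:E = \int[mu]_y (u y * v y)%:E)%E.
    by apply: eq_integral => y _; rewrite uv.
  apply: (le_trans (cauchy_schwarz_integral (f := u) (g := v) mu _ _ _)).
  - apply: msqrt; first exact: measurable_funM.
    by move=> y; rewrite mulr_ge0// ltW.
  - apply: measurable_funM; last exact: measurableT_comp.
    apply: msqrt; first exact: measurable_funM.
    by move=> y; rewrite mulr_ge0// invr_ge0 ltW.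
  - by move=> y; rewrite uv mulr_ge0.
  rewrite /F/=.
  under [leRHS]eq_integral do rewrite EFinM.
  rewrite ge0_integralZl_EFin//=; last 3 first.
  - move=> y _; rewrite lee_fin.
    exact: divr_ge0 (mulr_ge0 (k0 _ _) (sqr_ge0 _)) (ltW (w0 _)).
  - by apply/measurable_EFinP; do ![exact: measurable_funX|apply: measurable_funM].
  - exact: mulr_ge0 c0 (ltW (w0 _)).
  apply: lee_pmul => //.
  - by apply: integral_ge0 => y _; rewrite lee_fin sqr_ge0.
  - by apply: integral_ge0 => y _; rewrite lee_fin sqr_ge0.
  - apply: le_trans (kw x); rewrite le_eqVlt; apply/orP; left; apply/eqP.
    by apply: eq_integral => y _; rewrite sqr_sqrtr ?mulr_ge0// ltW.
  - rewrite le_eqVlt; apply/orP; left; apply/eqP.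
    apply: eq_integral => y _.
    rewrite exprMn sqr_sqrtr ?mulr_ge0 ?invr_ge0//; last exact: ltW.
    by rewrite real_normK ?num_real// mulrAC.
apply: le_trans (_ : \int[mu]_x \int[mu]_y F (x, y) <= _)%E.
  apply: ge0_le_integral_setT => // x; apply: mule_ge0;
  by apply: integral_ge0 => y _; rewrite lee_fin mulr_ge0.
have mF : measurable_fun setT F.
  apply/measurable_EFinP; apply: measurable_funM.
    apply: measurable_funM => //; exact: measurableT_comp.
  apply: measurable_funM; last exact: (measurableT_comp mwV).
  apply: measurable_funM => //; apply: measurable_funX.
  exact: measurableT_comp.
rewrite fubini_tonelli//.
rewrite -ge0_integralZl_EFin//; last 3 first.
- by move=> y _; rewrite lee_fin sqr_ge0.
- by apply/measurable_EFinP; exact: measurable_funX.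
- exact: sqr_ge0.
apply: ge0_le_integral_setT => y; first by apply: integral_ge0 => x _; exact: F0.
rewrite (_ : (\int[mu]_x F (x, y) =
  (c * (f y ^+ 2 / w y))%:E * \int[mu]_x (k y x * w x)%:E)%E); last first.
  rewrite -ge0_integralZl_EFin//.
  - apply: eq_integral => x _; rewrite /F/= -EFinM ksym; congr EFin; ring.
  - by move=> x _; rewrite lee_fin mulr_ge0// ltW.
  - by apply/measurable_EFinP; exact: measurable_funM.
  - exact: mulr_ge0 c0 (divr_ge0 (sqr_ge0 _) (ltW (w0 _))).
apply: (@le_trans _ _ ((c * (f y ^+ 2 / w y))%:E * (c * w y)%:E)%E).
  apply: lee_wpmul2l (kw y); rewrite lee_fin.
  exact: mulr_ge0 c0 (divr_ge0 (sqr_ge0 _) (ltW (w0 _))).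
rewrite -!EFinM lee_fin le_eqVlt; apply/orP; left; apply/eqP; field.
by rewrite gt_eqF.
Qed.

(** * The Mehler kernel *)

Lemma ge0_integral_normal_prob (R : realType) (m sigma : R) (f : R -> \bar R) :
  measurable_fun setT f -> (forall x, (0 <= f x)%E) ->
  (\int[normal_prob m sigma]_x f x =
   \int[lebesgue_measure]_x ((normal_pdf m sigma x)%:E * f x))%E.
Proof.
move=> mf f0; apply: ge0_integral_density => //.
- exact: measurable_normal_pdf.
- by move=> x; exact: normal_pdf_ge0.
Qed.

Section mehler.
Context {R : realType} (d : nat) (d2 : (2 <= d)%N).
Local Notation D := (d%:R : R).
Local Notation nud := (nu d : probability (measurableTypeR R) R).
Local Notation sigma := (Num.sqrt (D / (D ^+ 2 - 1))).
Local Notation s := (Num.sqrt (1 - D ^- 2)).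

Lemma deg_ge2 : 2 <= D. Proof. by rewrite ler_nat. Qed.

Lemma deg_gt0 : 0 < D. Proof. by have := deg_ge2; lra. Qed.

Lemma sqr_deg_sub1_gt0 : 0 < D ^+ 2 - 1. Proof. by have := deg_ge2; nra. Qed.

Lemma sigma_gt0 : 0 < sigma.
Proof. by rewrite sqrtr_gt0 divr_gt0 ?deg_gt0 ?sqr_deg_sub1_gt0. Qed.

Lemma sqr_sigma : sigma ^+ 2 = D / (D ^+ 2 - 1).
Proof. by rewrite sqr_sqrtr// divr_ge0// ltW ?deg_gt0 ?sqr_deg_sub1_gt0. Qed.

(** Here and below, sqrt (1 - d^-2) is called the step standard deviation: it
scales the Gaussian variable Y added to a / d in the definition of L. *)
Lemma step_var : 1 - D ^- 2 = (D ^+ 2 - 1) / D ^+ 2.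
Proof. by rewrite mulrBl mul1r divff// sqrf_eq0 gt_eqF ?deg_gt0. Qed.

Lemma step_sdE : s = Num.sqrt (D ^+ 2 - 1) / D.
Proof.
rewrite step_var sqrtrM ?ltW ?sqr_deg_sub1_gt0// sqrtrV ?sqr_ge0// sqrtr_sqr.
by rewrite gtr0_norm ?deg_gt0.
Qed.

Lemma step_sd_gt0 : 0 < s.
Proof. by rewrite step_sdE divr_gt0 ?deg_gt0// sqrtr_gt0 sqr_deg_sub1_gt0. Qed.

(** The density with respect to nu of the law of a / d + sqrt (1 - d^-2) Y. *)
Definition mehler (x y : R) : R :=
  D / Num.sqrt (D ^+ 2 - 1) * expR (x * y - (x ^+ 2 + y ^+ 2) / (2 * D)).

Lemma mehler_ge0 x y : 0 <= mehler x y.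
Proof. by rewrite mulr_ge0 ?expR_ge0// divr_ge0. Qed.

Lemma mehlerC x y : mehler x y = mehler y x.
Proof. by rewrite /mehler mulrC (mulrC x) (addrC (x ^+ 2)) mulrC. Qed.

Lemma measurable_mehler :
  measurable_fun setT (fun z : R * R => mehler z.1 z.2).
Proof.
apply: measurable_funM => //; apply: (measurableT_comp (f := @expR R)) => //=.
apply: measurable_funB; first exact: measurable_funM.
by apply: measurable_funM => //; apply: measurable_funD; exact: measurable_funX.
Qed.

Lemma mehler_pdf a z : s^-1 * normal_pdf 0 sigma ((z - a / D) / s) =
  mehler a z * normal_pdf 0 sigma z.
Proof.
have sg0 := lt0r_neq0 sigma_gt0; have D0 := deg_gt0; have D1 := sqr_deg_sub1_gt0.
rewrite normal_pdfE//= /mehler mulrCA [RHS]mulrCA; congr (_ * _).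
rewrite /normal_fun -(mulrA (D / _)) -expRD [in LHS]step_sdE invf_div.
congr (_ * expR _).
rewrite sqr_sigma !subr0 !exprMn exprVn sqr_sqrtr ?ltW//.
rewrite !mulr2n; field.
by rewrite (gt_eqF D1) (gt_eqF D0) (gt_eqF (addr_gt0 D0 D0)).
Qed.

(** The substitution z = a / d + sqrt (1 - d^-2) y moves the dependence on a
from the function into the density, where [mehler_pdf] separates it. *)
Lemma integral_mehler a (f : R -> \bar R) :
  measurable_fun setT f -> (forall x, (0 <= f x)%E) ->
  (\int[nud]_y f (a / D + s * y)%R = \int[nud]_y ((mehler a y)%:E * f y))%E.
Proof.
move=> mf f0.
rewrite ge0_integral_normal_prob//; last first.
  by apply: (measurableT_comp mf); apply: measurable_funD.
have mm : measurable_fun setT (mehler a).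
  exact: (measurable_fun_pair2 a measurable_mehler).
rewrite ge0_integral_normal_prob//; last 2 first.
- by apply: emeasurable_funM => //; exact/measurable_EFinP.
- by move=> y; rewrite mule_ge0// lee_fin mehler_ge0.
pose F z := ((s^-1 * normal_pdf 0 sigma ((z - a / D) / s))%:E * f z)%E.
transitivity (\int[lebesgue_measure]_z F z)%E; last first.
  apply: eq_integral => z _.
  by rewrite /F mehler_pdf muleA -EFinM [in RHS]mulrC.
rewrite -[RHS](@ge0_integral_affine _ (a / D) s)//; last 3 first.
- exact: step_sd_gt0.
- apply: emeasurable_funM => //; apply/measurable_EFinP.
  apply: measurable_funM => //.
  apply: (measurableT_comp (measurable_normal_pdf _ _)).
  by apply: measurable_funM => //; exact: measurable_funB.
- move=> x; rewrite mule_ge0// lee_fin.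
  by rewrite mulr_ge0 ?normal_pdf_ge0 ?invr_ge0 ?sqrtr_ge0.
have sn0 := lt0r_neq0 step_sd_gt0.
apply: eq_integral => y _; rewrite /F muleA -EFinM mulrA mulfV// mul1r.
by rewrite (addrC (a / D)) addrK [_ / s]mulrC mulKf.
Qed.

(** The kernel of a Markov operator: this is where the bound lambda_h <= d comes
from. *)
Lemma integral_mehler1 a : (\int[nud]_y (mehler a y)%:E = 1)%E.
Proof.
transitivity (\int[nud]_y ((mehler a y)%:E * 1))%E.
  by apply: eq_integral => y _; rewrite mule1.
rewrite -(@integral_mehler a (fun=> 1%E))// integral_cst// mul1e.
exact: (@probability_setT _ _ _ nud).
Qed.

End mehler.

(** * Gaussian tails *)

Section gauss_tail.
Context {R : realType}.
Local Notation N01 := (normal_prob 0 1 : probability (measurableTypeR R) R).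

(** Makes monotonicity and bounds of the tail facts about a probability
measure. *)
Lemma gauss_tail_normal_prob (b : R) :
  (gauss_tail b)%:E = normal_prob 0 (1 : R) `[b, +oo[.
Proof.
have pk : (Num.sqrt (2 * pi))^-1 = normal_peak (1 : R).
  by rewrite /normal_peak expr1n mul1r mulr_natl.
have -> : gauss_tail b =
    \int[lebesgue_measure]_(x in `[b, +oo[) normal_pdf 0 1 x.
  rewrite /gauss_tail pk -RintegralZl//; last first.
    have pk0 : normal_peak (1 : R) != 0.
      by rewrite gt_eqF// normal_peak_gt0// oner_neq0.
    have /(integrableZl _ (normal_peak (1 : R))^-1) : lebesgue_measure.-integrable
        `[b, +oo[ (fun x : R => (normal_pdf 0 (1 : R) x)%:E).
      by apply: (integrableS _ _ (subsetT _)) => //; exact: integrable_normal_pdf.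
    move=> /(_ (measurable_itv _)); apply: eq_integrable => // x _.
    rewrite /= -EFinM normal_pdfE ?oner_neq0// mulKf//.
    by rewrite /normal_fun subr0 expr1n mulNr.
  apply: eq_Rintegral => x _; rewrite normal_pdfE ?oner_neq0//.
  by rewrite /normal_fun subr0 expr1n mulNr.
rewrite /Rintegral fineK//.
have -> : (\int[lebesgue_measure]_(x in `[b, +oo[) (normal_pdf 0 1 x)%:E)%E =
   N01 `[b, +oo[%classic by [].
exact: fin_num_measure.
Qed.

Lemma gauss_tail_ge0 (b : R) : 0 <= gauss_tail b.
Proof. by rewrite -lee_fin gauss_tail_normal_prob. Qed.

Lemma gauss_tail_le1 (b : R) : gauss_tail b <= 1.
Proof.
rewrite -lee_fin gauss_tail_normal_prob.
exact: (@probability_le1 _ _ _ N01).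
Qed.

Lemma gauss_tail_decreasing (b c : R) : b < c -> gauss_tail c < gauss_tail b.
Proof.
move=> bc.
have itvE : `[b, +oo[%classic = `[b, c[%classic `|` `[c, +oo[%classic :> set R.
  by rewrite -itv_bndbnd_setU// ?bnd_simp ?ltW.
rewrite -lte_fin !gauss_tail_normal_prob itvE.
rewrite (measureU N01)//; last first.
  rewrite -subset0 => x [/=]; rewrite !in_itv/= => /andP[_ xc] /andP[cx _].
  by have := lt_le_trans xc cx; rewrite ltxx.
rewrite lteDr ?fin_num_measure//.
(* On [b, c) one has x^2 <= b^2 + c^2, so m bounds the density from below. *)
pose m := normal_peak (1 : R) * expR (- ((b ^+ 2 + c ^+ 2) / 2)).
have m0 : 0 < m by rewrite mulr_gt0 ?expR_gt0// normal_peak_gt0// oner_neq0.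
apply: (@lt_le_trans _ _ (m * (c - b))%:E).
  by rewrite lte_fin mulr_gt0// subr_gt0.
rewrite (_ : (m * (c - b))%:E = \int[lebesgue_measure]_(x in `[b, c[) m%:E)%E; last first.
  rewrite integral_cst//= lebesgue_measure_itv/= lte_fin bc EFinM.
  by rewrite EFinB.
apply: ge0_le_integral => //.
- by move=> x _; rewrite lee_fin ltW.
- apply: measurable_funTS; apply/measurable_EFinP; exact: measurable_normal_pdf.
- move=> x /=; rewrite in_itv/= => /andP[bx xc].
  rewrite lee_fin normal_pdfE ?oner_neq0// ler_pM2l ?normal_peak_gt0 ?oner_neq0//.
  rewrite ler_expR subr0 expr1n mulNr lerN2.
  have : x ^+ 2 <= b ^+ 2 + c ^+ 2 by case: (lerP 0 x) => x0; nra.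
  by move=> H; rewrite ler_wpM2r.
Qed.

Lemma gauss_tail_lt1 (b : R) : gauss_tail b < 1.
Proof.
apply: lt_le_trans (gauss_tail_le1 (b - 1)).
by apply: gauss_tail_decreasing; rewrite ltrBlDr ltrDl.
Qed.

Lemma gauss_tail_gt0 (b : R) : 0 < gauss_tail b.
Proof.
apply: le_lt_trans (gauss_tail_ge0 (b + 1)) _.
by apply: gauss_tail_decreasing; rewrite ltrDl.
Qed.

Lemma gauss_tail0 : gauss_tail (0 : R) = 2^-1.
Proof.
pose Neg : set R := `]-oo, 0[%classic; pose Pos : set R := `[0, +oo[%classic.
have : (normal_prob 0 (1 : R) Neg + normal_prob 0 (1 : R) Pos = 1)%E.
  rewrite -(measureU N01); last 3 first.
  - exact: measurable_itv.
  - exact: measurable_itv.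
  - rewrite -subset0 => x []; rewrite /Neg /Pos/= !in_itv/= andbT => xc cx.
    by have := lt_le_trans xc cx; rewrite ltxx.
  rewrite /Neg /Pos -itv_bndbnd_setU//.
  by rewrite set_itvE; exact: (@probability_setT _ _ _ N01).
have -> : normal_prob 0 (1 : R) Neg = normal_prob 0 (1 : R) Pos.
  have mp (A : set R) : measurable_fun A (EFin \o normal_pdf 0 (1 : R)).
    by apply: measurable_funTS; apply/measurable_EFinP; exact: measurable_normal_pdf.
  transitivity (normal_prob 0 (1 : R) (`]-oo, 0]%classic : set R)).
    exact: integral_itv_bndo_bndc.
  apply: esym; rewrite /normal_prob ge0_integration_by_substitution0//.
  - apply: eq_integral => x _.
    by rewrite !normal_pdfE ?oner_neq0// /normal_fun !subr0 sqrrN.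
  - by move=> x; rewrite lee_fin normal_pdf_ge0.
rewrite -gauss_tail_normal_prob -EFinD => -[H]; lra.
Qed.

Lemma ge0_integral_normal_prob0 (sigma : R) (f : R -> \bar R) :
  0 < sigma -> measurable_fun setT f -> (forall x, (0 <= f x)%E) ->
  (\int[normal_prob 0 sigma]_x f x = \int[normal_prob 0 1]_x f (sigma * x)%R)%E.
Proof.
move=> sg0 mf f0.
rewrite [RHS]ge0_integral_normal_prob//; last exact: (measurableT_comp mf).
rewrite [LHS]ge0_integral_normal_prob// -[LHS](@ge0_integral_affine _ 0 sigma)//; last 2 first.
- apply: emeasurable_funM => //; apply/measurable_EFinP; exact: measurable_normal_pdf.
- by move=> x; rewrite mule_ge0// lee_fin normal_pdf_ge0.
apply: eq_integral => x _; rewrite add0r muleA -EFinM; congr (_%:E * _)%E.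
rewrite !normal_pdfE ?gt_eqF ?ltr01// mulrA; congr (_ * _).
  rewrite /normal_peak expr1n mul1r -mulrnAr sqrtrM ?sqr_ge0// sqrtr_sqr gtr0_norm//.
  by rewrite invfM mulrA mulfV ?mul1r// gt_eqF.
rewrite /normal_fun !subr0 expr1n exprMn; congr expR.
by rewrite -mulrN -(mulr_natr (sigma ^+ 2)) -mulf_div mulfV ?mul1r// expf_neq0// gt_eqF.
Qed.

End gauss_tail.

(** * Operator norms on L2 through integrals of squares *)

Section L2_opnorm.
Context {R : realType} (mu : {measure set (measurableTypeR R) -> \bar R}).

Lemma Lnorm2_le (f : R -> R) (b : R) : 0 <= b ->
  ('N[mu]_2%:E[EFin \o f] <= b%:E)%E =
  (\int[mu]_x (f x ^+ 2)%:E <= (b ^+ 2)%:E)%E.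
Proof.
move=> b0; rewrite -Lnorm2_sqr -poweRe2 ?Lnorm_ge0//.
have -> : (b ^+ 2)%:E = (b%:E `^ 2)%E by rewrite poweRe2 ?lee_fin// -EFinM expr2.
apply/idP/idP => H.
  by apply: gt0_ler_poweR => //; rewrite in_itv/= ?Lnorm_ge0 ?lee_fin ?leey ?b0 ?ltry.
have -> : b%:E = ((b%:E `^ 2) `^ 2^-1)%E.
  by rewrite -poweRrM mulfV ?poweRe1 ?lee_fin// pnatr_eq0.
have -> : ('N[mu]_2%:E[EFin \o f])%E = (('N[mu]_2%:E[EFin \o f] `^ 2) `^ 2^-1)%E.
  by rewrite -poweRrM mulfV ?poweRe1 ?Lnorm_ge0// pnatr_eq0.
by apply: gt0_ler_poweR => //; rewrite in_itv/= leey andbT ?poweR_ge0 ?lee_fin ?powR_ge0.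
Qed.

Lemma L2_opnorm_ge (T : (R -> R) -> (R -> R)) (f : R -> R) :
  measurable_fun setT f -> (\int[mu]_x (f x ^+ 2)%:E <= 1)%E ->
  ('N[mu]_2%:E[EFin \o T f] <= L2_opnorm mu T)%E.
Proof.
move=> mf f1; apply: ereal_sup_ubound; exists f => //=.
have N1 : ('N[mu]_2%:E[EFin \o f] <= 1)%E.
  by rewrite Lnorm2_le// expr1n.
split => //; rewrite inE; apply/andP; split; first by rewrite inE.
rewrite inE /finite_norm/=; exact: le_lt_trans N1 (ltry _).
Qed.

Lemma L2_opnorm_le (T : (R -> R) -> (R -> R)) (b : R) : 0 <= b ->
  (forall f : R -> R, measurable_fun setT f ->
    (\int[mu]_x (f x ^+ 2)%:E <= 1)%E ->
    (\int[mu]_x (T f x ^+ 2)%:E <= (b ^+ 2)%:E)%E) ->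
  (L2_opnorm mu T <= b%:E)%E.
Proof.
move=> b0 H; apply: ge_ereal_sup => _ [f [/= fL f1] <-].
rewrite Lnorm2_le//; apply: H.
  by have /andP[+ _] := fL; rewrite inE.
by move: f1; rewrite Lnorm2_le// expr1n.
Qed.

Lemma L2_opnorm_ge0 (T : (R -> R) -> (R -> R)) : (0 <= L2_opnorm mu T)%E.
Proof.
have z1 : (\int[mu]_x (((fun=> 0) : R -> R) x ^+ 2)%:E <= 1)%E.
  by rewrite integral0_eq// => x _; rewrite expr0n.
by apply: le_trans (L2_opnorm_ge T _ z1); [exact: Lnorm_ge0|exact: measurable_cst].
Qed.

End L2_opnorm.

(** * The operator L_h as an integral operator *)

Section half_line_kernel.
Context {R : realType} (d : nat) (d2 : (2 <= d)%N).
Local Notation D := (d%:R : R).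
Local Notation nud := (nu d : probability (measurableTypeR R) R).
Local Notation sigma := (Num.sqrt (D / (D ^+ 2 - 1))).
Local Notation s := (Num.sqrt (1 - D ^- 2)).

Definition half_line_kernel (h x y : R) : R :=
  \1_(`[h, +oo[) x * \1_(`[h, +oo[) y * mehler d x y.

Lemma half_line_kernel_ge0 h x y : 0 <= half_line_kernel h x y.
Proof. by rewrite !mulr_ge0 ?mehler_ge0. Qed.

Lemma half_line_kernelC h x y : half_line_kernel h x y = half_line_kernel h y x.
Proof. by rewrite /half_line_kernel mehlerC (mulrC (\1_ _ x)). Qed.

Lemma half_line_kernel_le h x y : half_line_kernel h x y <= mehler d x y.
Proof.
by rewrite ler_piMl ?mehler_ge0// mulr_ile1// ?indic_le1//= !indicE; case: (_ \in _).
Qed.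

Lemma measurable_half_line (h : R) :
  measurable_fun setT (\1_(`[h, +oo[) : R -> R).
Proof. exact: measurable_indic. Qed.

Lemma measurable_half_line_kernel h :
  measurable_fun setT (fun z : R * R => half_line_kernel h z.1 z.2).
Proof.
apply: measurable_funM; last exact: measurable_mehler.
by apply: measurable_funM; apply: (measurableT_comp (measurable_half_line h)).
Qed.

Lemma measurable_half_line_kernel2 h x :
  measurable_fun setT (half_line_kernel h x).
Proof. exact: (measurable_fun_pair2 x (measurable_half_line_kernel h)). Qed.

Lemma step_sd_sigma : s * sigma = (Num.sqrt D)^-1.
Proof.
have D0 := deg_gt0 (R := R) d2; have D1 := sqr_deg_sub1_gt0 (R := R) d2.
rewrite -sqrtrM ?step_var//; last by rewrite divr_ge0 ?sqr_ge0 ?ltW.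
rewrite -sqrtrV ?ltW//; congr Num.sqrt; field.
by rewrite (gt_eqF D0) (gt_eqF D1).
Qed.

Lemma indic_half_lineP (h a : R) :
  \1_(`[h, +oo[) a = 1 :> R \/ \1_(`[h, +oo[) a = 0 :> R.
Proof. by rewrite indicE; case: (_ \in _); [left|right]. Qed.

(** Given a, the Gaussian step has mean a / d and variance 1 / d; see
[step_sd_sigma] for the variance. *)
Lemma integral_mehler_tail a h :
  (\int[nud]_y (mehler d a y * \1_(`[h, +oo[) y)%:E =
   (gauss_tail (Num.sqrt D * (h - a / D)))%:E)%E.
Proof.
have m1 : measurable_fun setT (EFin \o (\1_(`[h, +oo[) : R -> R)).
  by apply/measurable_EFinP; exact: measurable_half_line.
under eq_integral do rewrite EFinM.
rewrite -(@integral_mehler _ _ d2 a (EFin \o \1_(`[h, +oo[)))//; last first.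
  by move=> x; rewrite lee_fin.
rewrite ge0_integral_normal_prob0; last 3 first.
- exact: sigma_gt0.
- apply: (measurableT_comp m1); apply: measurable_funD => //.
- by move=> x; rewrite lee_fin.
rewrite gauss_tail_normal_prob.
set c := Num.sqrt D * _.
transitivity (\int[normal_prob 0 1]_x (\1_(`[c, +oo[) x)%:E)%E; last first.
  by rewrite integral_indic// setIT.
apply: eq_integral => x _ /=; congr EFin.
rewrite !indicE; congr (_%:R); rewrite !mem_setE !in_itv/= !andbT mulrA step_sd_sigma.
have q0 : 0 < Num.sqrt D by rewrite sqrtr_gt0 deg_gt0.
by rewrite -lerBlDl [_^-1 * x]mulrC ler_pdivlMr// /c mulrC.
Qed.

Lemma nu_half_line h : nu d `[h, +oo[%classic = (gauss_tail (h / sigma))%:E.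
Proof.
have sg0 := sigma_gt0 (R := R) d2.
transitivity (\int[nud]_x (\1_(`[h, +oo[) x)%:E)%E.
  by rewrite integral_indic// setIT.
have m1 : measurable_fun setT (EFin \o (\1_(`[h, +oo[) : R -> R)).
  by apply/measurable_EFinP; exact: measurable_half_line.
rewrite (@ge0_integral_normal_prob0 _ sigma (EFin \o \1_(`[h, +oo[)))//; last first.
  by move=> x; rewrite lee_fin.
rewrite gauss_tail_normal_prob.
transitivity (\int[normal_prob 0 1]_x (\1_(`[(h / sigma)%R, +oo[) x)%:E)%E; last first.
  by rewrite integral_indic// setIT.
apply: eq_integral => x _ /=; congr EFin.
by rewrite !indicE; congr (_%:R); rewrite !mem_setE !in_itv/= !andbT ler_pdivrMr// mulrC.
Qed.

Lemma Lh_op_ge0 h (f : R -> R) a :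
  measurable_fun setT f -> (forall x, 0 <= f x) ->
  Lh_op d h f a =
  D * fine (\int[nud]_y (half_line_kernel h a y * f y)%:E)%E.
Proof.
move=> mf f0.
rewrite /Lh_op {1}/pi_op /L_op unlock mulrCA; congr (_ * _).
have mpi : measurable_fun setT (EFin \o pi_op h f).
  by apply/measurable_EFinP; apply: measurable_funM => //; exact: measurable_half_line.
rewrite (@integral_mehler _ _ d2 a (EFin \o pi_op h f))//; last first.
  by move=> x; rewrite lee_fin mulr_ge0.
case: (indic_half_lineP h a) => ind1; rewrite ind1.
  rewrite mul1r; congr fine; apply: eq_integral => y _.
  rewrite -EFinM /half_line_kernel /pi_op ind1; congr EFin; ring.
rewrite mul0r; under eq_integral do rewrite /half_line_kernel ind1 !mul0r.
by rewrite integral0.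
Qed.

(** It suffices to control L_h on nonnegative functions; the right-hand side
may be infinite, in which case the left-hand side is computed from
fine +oo = 0. *)
Lemma Lh_op_le h (f : R -> R) a : measurable_fun setT f ->
  (`|Lh_op d h f a|%:E <=
   D%:E * \int[nud]_y (half_line_kernel h a y * `|f y|)%:E)%E.
Proof.
move=> mf.
have mpi : measurable_fun setT (EFin \o pi_op h f).
  by apply/measurable_EFinP; apply: measurable_funM => //; exact: measurable_half_line.
have mpa : measurable_fun setT (fun x => `|(EFin \o pi_op h f) x|)%E.
  exact: measurableT_comp.
rewrite /Lh_op {1}/pi_op /L_op mulrCA normrM (ger0_norm (ltW (deg_gt0 d2))).
rewrite EFinM lee_pmul2l ?lte_fin ?deg_gt0//.
rewrite normrM ger0_norm// unlock.
set E := (\int[_]_w _)%E.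
have EE : (`|fine E|%:E <= \int[nud]_y ((mehler d a y)%:E * `|(EFin \o pi_op h f) y|))%E.
  apply: (@le_trans _ _ `|E|)%E.
    by case: E => [x| |] //; exact: leey.
  rewrite -integral_mehler//; apply: le_abse_integral => //.
  apply: (measurableT_comp mpi); exact: measurable_funD.
case: (indic_half_lineP h a) => ind1; rewrite ind1.
  rewrite mul1r (le_trans EE)// le_eqVlt; apply/orP; left; apply/eqP.
  apply: eq_integral => y _ /=.
  rewrite -EFinM /half_line_kernel /pi_op normrM ind1 ger0_norm//; congr EFin; ring.
rewrite mul0r; apply: integral_ge0 => y _; rewrite lee_fin mulr_ge0//.
exact: half_line_kernel_ge0.
Qed.

(** For fixed a the kernel is bounded in y, because its exponent is at most
d a^2 / 2, and an L2 function is integrable for the finite measure nu. *)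
Lemma half_line_kernel_integral_lty h a (f : R -> R) :
  measurable_fun setT f -> (forall x, 0 <= f x) ->
  (\int[nud]_x (f x ^+ 2)%:E < +oo)%E ->
  (\int[nud]_y (half_line_kernel h a y * f y)%:E < +oo)%E.
Proof.
move=> mf f0 f2.
have D0 := deg_gt0 (R := R) d2.
pose C := D / Num.sqrt (D ^+ 2 - 1) * expR (D * a ^+ 2 / 2).
have C0 : 0 <= C by rewrite mulr_ge0 ?expR_ge0// divr_ge0.
apply: (@le_lt_trans _ _ (\int[nud]_y (C%:E * (1 + (f y ^+ 2)%:E)))%E).
  apply: ge0_le_integral_setT => y.
    by rewrite lee_fin mulr_ge0 ?half_line_kernel_ge0.
  rewrite -EFinD -EFinM lee_fin ler_pM ?half_line_kernel_ge0//.
    apply: le_trans (half_line_kernel_le _ _ _) _.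
    rewrite /mehler ler_wpM2l ?divr_ge0// ler_expR.
    rewrite -subr_ge0 (_ : _ - _ = ((y - D * a) ^+ 2 + a ^+ 2) / (2 * D)).
      by rewrite divr_ge0 ?addr_ge0 ?sqr_ge0// mulr_ge0// ltW.
    by field; rewrite gt_eqF.
  by have := f0 y; nra.
have m2 : measurable_fun setT (fun y : measurableTypeR R => (f y ^+ 2)%:E).
  by apply/measurable_EFinP; exact: measurable_funX.
rewrite ge0_integralZl_EFin//; last 2 first.
- by move=> y _; rewrite adde_ge0// lee_fin sqr_ge0.
- exact: emeasurable_funD.
rewrite ge0_integralD//; last by move=> y _; rewrite lee_fin sqr_ge0.
rewrite integral_cst// mul1e lte_mul_pinfty ?lee_fin// lte_add_pinfty//.
exact: le_lt_trans (@probability_le1 _ _ _ nud setT measurableT) (ltry _).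
Qed.

Lemma measurable_half_line_integral h (f : R -> R) :
  measurable_fun setT f -> (forall x, 0 <= f x) ->
  measurable_fun setT
    (fun x : R => \int[nud]_y (half_line_kernel h x y * f y)%:E)%E.
Proof.
move=> mf f0.
apply: (measurable_fun_fubini_tonelli_F (m2 := nud)
  (fun z : measurableTypeR R * measurableTypeR R =>
     (half_line_kernel h z.1 z.2 * f z.2)%:E)).
  apply/measurable_EFinP; apply: measurable_funM.
    exact: measurable_half_line_kernel.
  exact: (measurableT_comp mf).
by move=> z; rewrite lee_fin mulr_ge0 ?half_line_kernel_ge0.
Qed.

Lemma schur_half_line h (w f : R -> R) (c : R) :
  measurable_fun setT w -> (forall x, 0 < w x) -> 0 <= c ->
  (forall x, (\int[nud]_y (half_line_kernel h x y * w y)%:E <= (c * w x)%:E)%E) ->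
  measurable_fun setT f ->
  (\int[nud]_x (Lh_op d h f x ^+ 2)%:E <=
   ((D * c) ^+ 2)%:E * \int[nud]_x (f x ^+ 2)%:E)%E.
Proof.
move=> mw w0 c0 kw mf.
pose I a := (\int[nud]_y (half_line_kernel h a y * `|f y|)%:E)%E.
have I0 a : (0 <= I a)%E.
  by apply: integral_ge0 => y _; rewrite lee_fin mulr_ge0 ?half_line_kernel_ge0.
apply: (@le_trans _ _ (\int[nud]_x ((D ^+ 2)%:E * (I x * I x)))%E).
  apply: ge0_le_integral_setT => x; first by rewrite lee_fin sqr_ge0.
  rewrite -real_normK ?num_real// expr2 EFinM.
  apply: (@le_trans _ _ ((D%:E * I x) * (D%:E * I x)))%E.
    by apply: lee_pmul => //; exact: Lh_op_le.
  by rewrite muleACA -EFinM -expr2.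
rewrite ge0_integralZl_EFin//; last 2 first.
- by move=> x _; exact: mule_ge0.
- have mI : measurable_fun setT I.
    by apply: measurable_half_line_integral => //; exact: measurableT_comp.
  exact: emeasurable_funM.
rewrite exprMn (EFinM (D ^+ 2)) -muleA lee_pmul2l ?lte_fin ?exprn_gt0 ?deg_gt0//.
apply: (schur_test (mu := nud) (k := half_line_kernel h) _ mw mf _ _ w0 c0 kw).
- exact: measurable_half_line_kernel.
- exact: half_line_kernel_ge0.
- exact: half_line_kernelC.
Qed.

(** The Schur test with constant weight. *)
Lemma L2_opnorm_le_deg h : (L2_opnorm nud (Lh_op d h) <= D%:E)%E.
Proof.
apply: L2_opnorm_le => [|f mf f1]; first by rewrite ltW// deg_gt0.
have k1 x : (\int[nud]_y (half_line_kernel h x y * 1)%:E <= (1 * 1 : R)%:E)%E.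
  rewrite mulr1 -(integral_mehler1 d2 x).
  apply: ge0_le_integral_setT => y; rewrite lee_fin mulr1.
    exact: half_line_kernel_ge0.
  exact: half_line_kernel_le.
have := schur_half_line (measurable_cst (1 : R)) (fun=> ltr01) ler01 k1 mf.
rewrite mulr1 => /le_trans; apply.
by rewrite -[leRHS]mule1 lee_wpmul2l ?lee_fin ?sqr_ge0.
Qed.

(** The operator norm is finite, so that [fine] loses nothing. *)
Lemma lambdaE h : (lambda d h : R)%:E = L2_opnorm nud (Lh_op d h).
Proof.
rewrite /lambda fineK// fin_num_abs gee0_abs ?L2_opnorm_ge0//.
exact: le_lt_trans (L2_opnorm_le_deg h) (ltry _).
Qed.

End half_line_kernel.

(** * The lower bound *)

Section lower_bound.
Context {R : realType} (d : nat) (d2 : (2 <= d)%N).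
Local Notation D := (d%:R : R).
Local Notation nud := (nu d : probability (measurableTypeR R) R).
Local Notation sigma := (Num.sqrt (D / (D ^+ 2 - 1))).

Lemma integral_indic_half_line (h c : R) : 0 <= c ->
  (\int[nud]_x (c * \1_(`[h, +oo[) x)%:E = (c * gauss_tail (h / sigma))%:E)%E.
Proof.
move=> c0; under eq_integral do rewrite EFinM.
rewrite ge0_integralZl_EFin//.
  rewrite EFinM -nu_half_line//; congr (_ * _)%E.
  by rewrite integral_indic// setIT.
by apply/measurable_EFinP; exact: measurable_half_line.
Qed.

Lemma indic_half_line_sqr (h x : R) :
  \1_(`[h, +oo[) x ^+ 2 = \1_(`[h, +oo[) x :> R.
Proof. by have [->|->] := indic_half_lineP h x; rewrite ?expr1n ?expr0n. Qed.

(** For the normalised indicator f of [h, oo), the image L_h f is d b(a) f(a)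
with b strictly increasing, so its squared norm is an average of (d b(a))^2 over
a >= h.  Strictness is made quantitative by comparing b(a) with b(h + 1) for
a >= h + 1. *)
Lemma lambda_gt h :
  D * gauss_tail (h * ((D - 1) / Num.sqrt D)) < lambda d h.
Proof.
have D0 := deg_gt0 (R := R) d2; have sg0 := sigma_gt0 (R := R) d2.
pose b a := gauss_tail (Num.sqrt D * (h - a / D)).
have q0 : 0 < Num.sqrt D by rewrite sqrtr_gt0.
have -> : gauss_tail (h * ((D - 1) / Num.sqrt D)) = b h.
  rewrite /b; congr gauss_tail; apply: (mulIf (lt0r_neq0 q0)).
  have -> : Num.sqrt D * (h - h / D) * Num.sqrt D = D * (h - h / D).
    by rewrite mulrAC -expr2 sqr_sqrtr// ltW.
  by rewrite mulrA divfK ?gt_eqF//; field; rewrite gt_eqF.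
have b_incr x y : x < y -> b x < b y.
  move=> xy; apply: gauss_tail_decreasing; rewrite ltr_pM2l// ltrD2l ltrN2.
  by rewrite ltr_pM2r// invr_gt0.
have b_homo x y : x <= y -> b x <= b y.
  by rewrite le_eqVlt => /predU1P[->//|/b_incr/ltW].
have b0 x : 0 < b x := gauss_tail_gt0 _.
pose N := gauss_tail (h / sigma); pose N' := gauss_tail ((h + 1) / sigma).
have N0 : 0 < N := gauss_tail_gt0 _; have N'0 : 0 < N' := gauss_tail_gt0 _.
pose f (x : R) := (Num.sqrt N)^-1 * \1_(`[h, +oo[) x.
have f0 x : 0 <= f x by rewrite mulr_ge0 ?invr_ge0.
have mf : measurable_fun setT f.
  by apply: measurable_funM => //; exact: measurable_half_line.
have f2 : (\int[nud]_x (f x ^+ 2)%:E <= 1)%E.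
  under eq_integral do rewrite exprMn indic_half_line_sqr exprVn sqr_sqrtr ?ltW//.
  by rewrite integral_indic_half_line ?invr_ge0 ?(ltW N0)// (mulVf (lt0r_neq0 N0)).
have LfE a : Lh_op d h f a = D * ((Num.sqrt N)^-1 * \1_(`[h, +oo[) a * b a).
  rewrite Lh_op_ge0//; congr (_ * _).
  have -> : (\int[nud]_y (half_line_kernel d h a y * f y)%:E)%E =
      (\int[nud]_y (((Num.sqrt N)^-1 * \1_(`[h, +oo[) a)%:E *
                    (mehler d a y * \1_(`[h, +oo[) y)%:E))%E.
    apply: eq_integral => y _; rewrite -EFinM; congr EFin.
    rewrite /half_line_kernel /f -[in RHS](indic_half_line_sqr h y); ring.
  rewrite ge0_integralZl_EFin//; last 2 first.
  - by move=> y _; rewrite lee_fin mulr_ge0 ?mehler_ge0.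
  - apply/measurable_EFinP; apply: measurable_funM; last exact: measurable_half_line.
    exact: (measurable_fun_pair2 a (measurable_mehler d)).
  by rewrite integral_mehler_tail.
rewrite ltNge; apply/negP => lam_le.
have : (\int[nud]_x (Lh_op d h f x ^+ 2)%:E <= ((D * b h) ^+ 2)%:E)%E.
  rewrite -Lnorm2_le; last by rewrite mulr_ge0 ?ltW.
  apply: (le_trans (L2_opnorm_ge (Lh_op d h) mf f2)).
  by rewrite -lambdaE// lee_fin.
apply/negP; rewrite -ltNge.
pose c1 := D ^+ 2 / N * b h ^+ 2.
pose c2 := D ^+ 2 / N * (b (h + 1) ^+ 2 - b h ^+ 2).
have DN0 : 0 < D ^+ 2 / N by rewrite divr_gt0// exprn_gt0.
have c10 : 0 < c1 by rewrite mulr_gt0// exprn_gt0.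
have b1 : b h < b (h + 1) by apply: b_incr; rewrite ltrDl.
have c20 : 0 < c2.
  by rewrite mulr_gt0// subr_gt0 ltrXn2r ?ltW.
apply: (@lt_le_trans _ _ (\int[nud]_x ((c1 * \1_(`[h, +oo[) x)%:E +
   (c2 * \1_(`[h + 1, +oo[) x)%:E)))%E.
  rewrite ge0_integralD//; last 4 first.
  - by move=> x _; rewrite lee_fin; apply: mulr_ge0 => //; exact: ltW.
  - by apply/measurable_EFinP; apply: measurable_funM => //; exact: measurable_half_line.
  - by move=> x _; rewrite lee_fin; apply: mulr_ge0 => //; exact: ltW.
  - by apply/measurable_EFinP; apply: measurable_funM => //; exact: measurable_half_line.
  rewrite !integral_indic_half_line ?ltW// -EFinD lte_fin -/N -/N'.
  have -> : c1 * N = (D * b h) ^+ 2 by rewrite /c1; field; rewrite gt_eqF.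
  by rewrite ltrDl mulr_gt0.
apply: ge0_le_integral_setT => x.
  by rewrite -EFinD lee_fin; apply: addr_ge0; apply: mulr_ge0 => //; exact: ltW.
rewrite -EFinD lee_fin LfE.
have -> : (D * ((Num.sqrt N)^-1 * \1_(`[h, +oo[) x * b x)) ^+ 2 =
    D ^+ 2 / N * (\1_(`[h, +oo[) x * b x ^+ 2).
  rewrite !exprMn indic_half_line_sqr exprVn sqr_sqrtr ?ltW//; ring.
rewrite /c1 /c2 -!(mulrA (D ^+ 2 / N)) -!mulrDr ler_pM2l//.
rewrite !indicE !mem_setE !in_itv/= !andbT.
have [hx|xh] := leP h x; have [h1x|xh1] := leP (h + 1) x;
  rewrite ?mulr0 ?mulr1 ?mul0r ?mul1r ?addr0.
- by rewrite subrKC ler_pXn2r ?nnegrE ?(ltW (b0 _))// b_homo.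
- by rewrite ler_pXn2r ?nnegrE ?(ltW (b0 _))// ?b_homo.
- exfalso; lra.
- by [].
Qed.

End lower_bound.

(** * The strict upper bound at level 0 *)

Section gap.
Context {R : realType} (d : nat) (d2 : (2 <= d)%N).
Local Notation D := (d%:R : R).
Local Notation nud := (nu d : probability (measurableTypeR R) R).
Local Notation sigma := (Num.sqrt (D / (D ^+ 2 - 1))).

(** From |x| <= 1 + x^2 / 4 <= exp (x^2 / 4): the factor exp (x^2 / 4) turns the
standard Gaussian density into sqrt 2 times the one of variance 2. *)
Lemma integral_norm_normal01_le :
  (\int[normal_prob 0 (1 : R)]_x `|x|%:E <= (Num.sqrt 2)%:E)%E.
Proof.
have r20 : 0 < Num.sqrt 2 :> R by rewrite sqrtr_gt0.
rewrite ge0_integral_normal_prob//; last by apply/measurable_EFinP; exact: normr_measurable.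
apply: (@le_trans _ _ (\int[lebesgue_measure]_x
    ((Num.sqrt 2)%:E * (normal_pdf 0 (Num.sqrt 2) x)%:E))%E).
  apply: ge0_le_integral_setT => x.
    by rewrite mule_ge0// lee_fin normal_pdf_ge0.
  rewrite -!EFinM lee_fin !normal_pdfE ?gt_eqF ?oner_neq0//.
  have -> : normal_peak (1 : R) = Num.sqrt 2 * normal_peak (Num.sqrt 2).
    rewrite /normal_peak expr1n mul1r -[in RHS]mulrnAr sqrtrM ?sqr_ge0//.
    by rewrite sqrtr_sqr gtr0_norm// invfM mulrA mulfV ?mul1r// gt_eqF.
  rewrite -!mulrA ler_pM2l// ler_pM2l ?normal_peak_gt0 ?gt_eqF//.
  rewrite /normal_fun !subr0 sqr_sqrtr// expr1n.
  have -> : expR (- x ^+ 2 / (2 *+ 2)) =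
      expR (- x ^+ 2 / (1 *+ 2)) * expR (x ^+ 2 / 4).
    by rewrite -expRD; congr expR; rewrite !mulr2n; field.
  rewrite ler_pM2l ?expR_gt0//.
  apply: le_trans (expR_ge1Dx _).
  rewrite -subr_ge0 (_ : _ - _ = (`|x| / 2 - 1) ^+ 2) ?sqr_ge0//.
  by rewrite -(real_normK (num_real x)); field.
rewrite ge0_integralZl_EFin//.
- by rewrite integral_normal_pdf mule1.
- by move=> x _; rewrite lee_fin normal_pdf_ge0.
- by apply/measurable_EFinP; exact: measurable_normal_pdf.
Qed.

Lemma integral_mehler_norm_le a :
  (\int[nud]_y (mehler d a y * `|y|)%:E <= (`|a| / 2 + sigma * Num.sqrt 2)%:E)%E.
Proof.
have D0 := deg_gt0 (R := R) d2; have D2 := deg_ge2 (R := R) d2.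
have sg0 := sigma_gt0 (R := R) d2.
have mn : measurable_fun setT (EFin \o @Num.norm R R).
  by apply/measurable_EFinP; exact: normr_measurable.
under eq_integral do rewrite EFinM.
rewrite -(integral_mehler d2 a mn)//; last by move=> x; rewrite lee_fin.
apply: (@le_trans _ _ (\int[nud]_y ((`|a| / 2)%:E + `|y|%:E))%E).
  apply: ge0_le_integral_setT => y; first by rewrite lee_fin.
  rewrite -EFinD lee_fin (le_trans (ler_normD _ _))// !normrM lerD//.
    by rewrite ler_wpM2l// gtr0_norm ?invr_gt0// lef_pV2 ?posrE.
  rewrite ler_piMl// ger0_norm// -[leRHS]sqrtr1 ler_wsqrtr// gerBl.
rewrite ge0_integralD//.
rewrite integral_cst// EFinD; apply: leeD.
  rewrite -[leRHS]mule1; apply: lee_wpmul2l; first by rewrite lee_fin.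
  exact: (@probability_le1 _ _ _ nud).
rewrite (ge0_integral_normal_prob0 sg0 mn)//; last by move=> x; rewrite lee_fin.
under eq_integral do rewrite /= normrM (gtr0_norm sg0) EFinM.
rewrite ge0_integralZl_EFin//.
by rewrite EFinM lee_pmul2l ?lte_fin// integral_norm_normal01_le.
Qed.

(** Schur test on [0, oo) with the weight C + |x|.  With B bounding the first
absolute moment of nu, p(x) the probability that the step from x
stays in [0, oo) and delta <= 1 - p(8 B), the weight C = 2 B / delta is mapped
to at most C p(x) + x / 2 + B.  For x <= 8 B the loss C delta = 2 B outweighs B;
for x >= 8 B the contraction of x by 1 / 2 does.  In both cases the factor
1 - delta / 2 remains, since C delta / 2 = B and 1 - delta / 2 >= 3 / 4. *)
Lemma lambda0_lt : lambda d (0 : R) < D.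
Proof.
have D0 := deg_gt0 (R := R) d2.
pose B := sigma * Num.sqrt 2.
have B0 : 0 < B by rewrite mulr_gt0 ?sigma_gt0// sqrtr_gt0.
pose p x := gauss_tail (Num.sqrt D * (0 - x / D)).
have p_homo x y : x <= y -> p x <= p y.
  rewrite le_eqVlt => /predU1P[->//|xy]; apply/ltW/gauss_tail_decreasing.
  by rewrite ltr_pM2l ?sqrtr_gt0// ltrD2l ltrN2 ltr_pM2r// invr_gt0.
pose delta := Num.min (1 - p (8 * B)) (2^-1).
have del0 : 0 < delta by rewrite lt_min subr_gt0 gauss_tail_lt1/= invr_gt0.
have [del1 del2] : delta <= 1 - p (8 * B) /\ delta <= 2^-1.
  by rewrite !ge_min !lexx/= orbT.
pose c := 2 * B / delta.
have c0 : 0 < c by rewrite divr_gt0// mulr_gt0.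
have cdel : c * delta = 2 * B by rewrite divfK// gt_eqF.
pose kap := 1 - delta / 2.
have kap0 : 0 <= kap by rewrite /kap; lra.
pose w (x : R) := c + `|x|.
have w0 x : 0 < w x by rewrite ltr_wpDr.
have mw : measurable_fun setT w by apply: measurable_funD => //; exact: normr_measurable.
have kw x : (\int[nud]_y (half_line_kernel d 0 x y * w y)%:E <= (kap * w x)%:E)%E.
  have [x0|x0] := leP 0 x; last first.
    rewrite integral0_eq => [|y _]; first by rewrite lee_fin mulr_ge0// ltW.
    by rewrite /half_line_kernel indicE mem_setE in_itv/= leNgt x0 !mul0r.
  apply: (@le_trans _ _ (\int[nud]_y (c%:E * (mehler d x y * \1_(`[0%R, +oo[) y)%:E +
      (mehler d x y * `|y|)%:E))%E).
    apply: ge0_le_integral_setT => y.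
      by rewrite lee_fin mulr_ge0 ?half_line_kernel_ge0 ?ltW.
    rewrite -EFinM -EFinD lee_fin /w mulrDr lerD//.
      rewrite mulrC ler_pM2l// /half_line_kernel mulrC (mulrC (\1_ _ x)) mulrA.
      by rewrite ler_piMr ?mulr_ge0 ?mehler_ge0//; have [->|->] := indic_half_lineP 0 x.
    by rewrite ler_wpM2r ?half_line_kernel_le.
  have mm : measurable_fun setT (mehler d x).
    exact: (measurable_fun_pair2 x (measurable_mehler d)).
  rewrite ge0_integralD//; last 4 first.
  - move=> y _; rewrite -EFinM lee_fin; apply: mulr_ge0; first exact: ltW.
    by rewrite mulr_ge0 ?mehler_ge0.
  - apply: emeasurable_funM => //; apply/measurable_EFinP.
    by apply: measurable_funM => //; exact: measurable_half_line.
  - by move=> y _; rewrite lee_fin mulr_ge0 ?mehler_ge0.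
  - by apply/measurable_EFinP; apply: measurable_funM => //; exact: normr_measurable.
  rewrite ge0_integralZl_EFin ?(ltW c0)//; last 2 first.
  - by move=> y _; rewrite lee_fin mulr_ge0 ?mehler_ge0.
  - by apply/measurable_EFinP; apply: measurable_funM => //; exact: measurable_half_line.
  rewrite integral_mehler_tail// -/(p x).
  apply: (@le_trans _ _ (c%:E * (p x)%:E + (`|x| / 2 + B)%:E)%E).
    by apply: leeD2l; exact: integral_mehler_norm_le.
  rewrite -EFinM -EFinD lee_fin -/B /w ger0_norm// /kap.
  have [xA|Ax] := leP x (8 * B).
    have := p_homo _ _ xA; move: (p x) => px pxle.
    have : c * px <= c * (1 - delta) by rewrite ler_pM2l//; lra.
    nra.
  have : c * p x <= c by rewrite ler_piMr ?ltW// gauss_tail_lt1.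
  nra.
have lam : (L2_opnorm nud (Lh_op d 0) <= (D * kap)%:E)%E.
  apply: L2_opnorm_le => [|f mf f1]; first by rewrite mulr_ge0// ltW.
  apply: (le_trans (schur_half_line d2 mw w0 kap0 kw mf)).
  by rewrite -[leRHS]mule1 lee_wpmul2l ?lee_fin ?sqr_ge0.
move: lam; rewrite -lambdaE// lee_fin => /le_lt_trans; apply.
by rewrite gtr_pMr// /kap; lra.
Qed.

End gap.

(** * Exponential decay by translation *)

Section shift.
Context {R : realType} (d : nat) (d2 : (2 <= d)%N).
Local Notation D := (d%:R : R).
Local Notation nud := (nu d : probability (measurableTypeR R) R).
Local Notation sigma := (Num.sqrt (D / (D ^+ 2 - 1))).

(** The square root of the density of the translate of nu by - h with respect
to nu. *)
Definition sqrt_shift_density (h x : R) : R :=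
  expR (- ((2 * x * h + h ^+ 2) * ((D ^+ 2 - 1) / (4 * D)))).
Local Notation r := sqrt_shift_density.

Lemma measurable_sqrt_shift_density h : measurable_fun setT (r h).
Proof.
apply: (measurableT_comp (f := @expR R)) => //=.
apply: measurableT_comp => //; apply: measurable_funM => //.
by apply: measurable_funD => //; do !apply: measurable_funM => //.
Qed.

Lemma cameron_martin h (F : R -> \bar R) :
  measurable_fun setT F -> (forall x, (0 <= F x)%E) ->
  (\int[nud]_x F x = \int[nud]_x ((r h x ^+ 2)%:E * F (h + x)%R))%E.
Proof.
move=> mF F0; have D0 := deg_gt0 (R := R) d2; have D1 := sqr_deg_sub1_gt0 (R := R) d2.
have sg0 := sigma_gt0 (R := R) d2.
have mFh : measurable_fun setT (fun x : R => F (h + x)).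
  by apply: (measurableT_comp mF); exact: measurable_funD.
rewrite [LHS]ge0_integral_normal_prob// [RHS]ge0_integral_normal_prob//; last 2 first.
- apply: emeasurable_funM => //; apply/measurable_EFinP; apply: measurable_funX.
  exact: measurable_sqrt_shift_density.
- by move=> x; rewrite mule_ge0// lee_fin sqr_ge0.
rewrite -[LHS](@ge0_integral_affine _ h 1)//; last 2 first.
- by apply: emeasurable_funM => //; apply/measurable_EFinP; exact: measurable_normal_pdf.
- by move=> x; rewrite mule_ge0// lee_fin normal_pdf_ge0.
apply: eq_integral => x _; rewrite mul1e mul1r muleA -EFinM; congr (_%:E * _)%E.
rewrite !normal_pdfE ?gt_eqF// -mulrA; congr (_ * _).
rewrite /normal_fun /r -expRM_natl -expRD; congr expR.
rewrite sqr_sigma// !subr0 mulr2n; field.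
by rewrite (gt_eqF D1) (gt_eqF D0) (gt_eqF (addr_gt0 D0 D0)).
Qed.

(** The exponents differ by h (x + y) (d - 1)^2 / (2 d), which is nonnegative on
the support of the right-hand side. *)
Lemma half_line_kernel_shift h x y : 0 <= h ->
  half_line_kernel d h (h + x) (h + y) * (r h x * r h y) <=
  expR (- (h ^+ 2 * (D - 1) ^+ 2 / (2 * D))) * half_line_kernel d 0 x y.
Proof.
move=> h0; have D0 := deg_gt0 (R := R) d2.
have ind z : \1_(`[h, +oo[) (h + z) = \1_(`[0, +oo[) z :> R.
  by rewrite !indicE !mem_setE !in_itv/= !andbT lerDl.
rewrite /half_line_kernel !ind.
rewrite [leRHS]mulrCA -[leLHS]mulrA.
rewrite !indicE !mem_setE !in_itv/= !andbT.
have [x0|_] := leP 0 x; last by rewrite !mul0r.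
have [y0|_] := leP 0 y; last by rewrite !mulr0 !mul0r.
rewrite !mul1r /mehler -(mulrA (D / _)) [leRHS]mulrCA ler_wpM2l ?divr_ge0//.
rewrite /r -!expRD ler_expR -subr_ge0.
rewrite [X in 0 <= X](_ : _ = h * (x + y) * ((D - 1) ^+ 2 / (2 * D))).
  apply: mulr_ge0; first exact: mulr_ge0 h0 (addr_ge0 x0 y0).
  by rewrite divr_ge0 ?sqr_ge0// mulr_ge0// ltW.
by field; rewrite gt_eqF.
Qed.

Lemma lambda_ge0 h : 0 <= lambda d h :> R.
Proof. by rewrite -lee_fin lambdaE// L2_opnorm_ge0. Qed.

(** For f in the unit ball, g(x) = |f(h + x)| r_h(x) on [0, oo) is again in the
unit ball by the Cameron-Martin formula, and the kernel inequality gives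
(L_h |f|)(h + x) r_h(x) <= e (L_0 g)(x) pointwise, with e the exponential
factor.  Taking L2 norms concludes. *)
Lemma lambda_le_exp (h : R) : 0 <= h ->
  lambda d h <= lambda d 0 * expR (- (h ^+ 2 * (D - 1) ^+ 2 / (2 * D))).
Proof.
move=> h0; have D0 := deg_gt0 (R := R) d2.
set e := expR _; have e0 : 0 <= e := expR_ge0 _.
rewrite -lee_fin lambdaE//.
apply: L2_opnorm_le => [|f mf f1]; first by rewrite mulr_ge0// lambda_ge0.
pose g (x : R) := \1_(`[0, +oo[) x * (`|f (h + x)| * r h x).
have r0 x : 0 < r h x := expR_gt0 _.
have g0 x : 0 <= g x by rewrite !mulr_ge0// ltW.
have mr := measurable_sqrt_shift_density h.
have mfh : measurable_fun setT (fun x : R => `|f (h + x)|).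
  apply: measurableT_comp => //; apply: (measurableT_comp mf).
  exact: measurable_funD.
have mg : measurable_fun setT g.
  by apply: measurable_funM; [exact: measurable_half_line|exact: measurable_funM].
have g1 : (\int[nud]_x (g x ^+ 2)%:E <= 1)%E.
  apply: le_trans f1.
  rewrite [leRHS](cameron_martin h)//; last 2 first.
  - by apply/measurable_EFinP; exact: measurable_funX.
  - by move=> x; rewrite lee_fin sqr_ge0.
  apply: ge0_le_integral_setT => x; first by rewrite lee_fin sqr_ge0.
  rewrite -EFinM lee_fin /g !exprMn indic_half_line_sqr real_normK ?num_real//.
  rewrite [leRHS]mulrC ler_piMl//.
  exact: mulr_ge0 (sqr_ge0 _) (sqr_ge0 _).
pose I a := (\int[nud]_y (half_line_kernel d h a y * `|f y|)%:E)%E.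
have I0 a : (0 <= I a)%E.
  by apply: integral_ge0 => y _; rewrite lee_fin mulr_ge0 ?half_line_kernel_ge0.
have mI : measurable_fun setT I.
  by apply: measurable_half_line_integral => //; exact: measurableT_comp.
(* The comparison of L_h |f| with L_0 g; g has a finite integral against the
   kernel, so that L_0 g is not truncated by [fine]. *)
have Ishift x : (D%:E * ((r h x)%:E * I (h + x)%R) <= e%:E * (Lh_op d 0 g x)%:E)%E.
  have Jfin : (\int[nud]_y (half_line_kernel d 0 x y * g y)%:E)%E \is a fin_num.
    rewrite ge0_fin_numE.
      by apply: half_line_kernel_integral_lty => //; exact: le_lt_trans g1 (ltry _).
    by apply: integral_ge0 => y _; rewrite lee_fin mulr_ge0 ?half_line_kernel_ge0.
  rewrite Lh_op_ge0// EFinM fineK// [leRHS]muleCA lee_pmul2l ?lte_fin//.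
  have mk a : measurable_fun setT (fun y : R => half_line_kernel d h a y).
    exact: measurable_half_line_kernel2.
  rewrite /I (cameron_martin h)//; last 2 first.
  - apply/measurable_EFinP; apply: measurable_funM => //; exact: measurableT_comp.
  - by move=> y; rewrite lee_fin mulr_ge0 ?half_line_kernel_ge0.
  rewrite -ge0_integralZl_EFin//; last 3 first.
  - by move=> y _; rewrite mule_ge0// lee_fin ?sqr_ge0// mulr_ge0 ?half_line_kernel_ge0.
  - apply: emeasurable_funM; first by apply/measurable_EFinP; exact: measurable_funX.
    apply/measurable_EFinP; apply: measurable_funM => //.
    by apply: (measurableT_comp (mk _)); exact: measurable_funD.
  - exact: ltW.
  rewrite -ge0_integralZl_EFin//; last 2 first.
  - by move=> y _; rewrite lee_fin mulr_ge0 ?half_line_kernel_ge0.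
  - apply/measurable_EFinP; apply: measurable_funM => //.
    exact: measurable_half_line_kernel2.
  apply: ge0_le_integral_setT => y.
    rewrite -!EFinM lee_fin !mulr_ge0 ?half_line_kernel_ge0 ?sqr_ge0//; exact: ltW.
  rewrite -!EFinM lee_fin.
  have -> : r h x * (r h y ^+ 2 * (half_line_kernel d h (h + x) (h + y) * `|f (h + y)|)) =
     half_line_kernel d h (h + x) (h + y) * (r h x * r h y) * (`|f (h + y)| * r h y) by ring.
  have -> : e * (half_line_kernel d 0 x y * g y) =
     e * half_line_kernel d 0 x y * (`|f (h + y)| * r h y).
    rewrite /g /half_line_kernel -[in RHS](indic_half_line_sqr 0 y); ring.
  by rewrite ler_wpM2r ?mulr_ge0 ?half_line_kernel_shift// ltW.
apply: (@le_trans _ _ (\int[nud]_a ((D%:E * I a) * (D%:E * I a)))%E).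
  apply: ge0_le_integral_setT => x; first by rewrite lee_fin sqr_ge0.
  rewrite -real_normK ?num_real// expr2 EFinM.
  by apply: lee_pmul => //; exact: Lh_op_le.
have DI0 a : (0 <= D%:E * I a)%E by rewrite mule_ge0// lee_fin ltW.
rewrite (cameron_martin h); last 2 first.
- by apply: emeasurable_funM; apply: emeasurable_funM.
- by move=> x; exact: mule_ge0.
apply: (@le_trans _ _ (\int[nud]_x ((e ^+ 2)%:E * (Lh_op d 0 g x ^+ 2)%:E))%E).
  apply: ge0_le_integral_setT => x.
    by rewrite mule_ge0 ?lee_fin ?sqr_ge0// mule_ge0.
  have -> : ((r h x ^+ 2)%:E * (D%:E * I (h + x)%R * (D%:E * I (h + x)%R)) =
    (D%:E * ((r h x)%:E * I (h + x)%R)) * (D%:E * ((r h x)%:E * I (h + x)%R)))%E.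
    by rewrite expr2 EFinM (muleCA D%:E) muleACA.
  have -> : ((e ^+ 2)%:E * (Lh_op d 0 g x ^+ 2)%:E =
    (e%:E * (Lh_op d 0 g x)%:E) * (e%:E * (Lh_op d 0 g x)%:E))%E.
    by rewrite !expr2 !EFinM muleACA.
  by apply: lee_pmul => //; rewrite muleCA mule_ge0// lee_fin ltW.
rewrite ge0_integralZl_EFin ?sqr_ge0//; last 2 first.
- by move=> x _; rewrite lee_fin sqr_ge0.
- apply/measurable_EFinP; apply: measurable_funX.
  rewrite (_ : Lh_op d 0 g = fun x => D * fine
      (\int[nud]_y (half_line_kernel d 0 x y * g y)%:E)%E); last first.
    by apply/funext => x; exact: Lh_op_ge0.
  apply: measurable_funM => //; apply: (measurableT_comp (f := @fine R)) => //.
  exact: measurable_half_line_integral.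
rewrite (mulrC (lambda d 0)) exprMn (EFinM (e ^+ 2)) lee_wpmul2l ?lee_fin ?sqr_ge0//.
rewrite -Lnorm2_le ?lambda_ge0// lambdaE//.
exact: L2_opnorm_ge.
Qed.

End shift.

Theorem theorem4p3 (R : realType) (d : nat) (hd : (2 <= d)%N) :
  ((forall h : R,
      d%:R * gauss_tail (h * ((d%:R - 1) / Num.sqrt d%:R)) < lambda d h) /\
   d%:R / 2 < lambda d (0 : R)) /\
  (forall h : R, 0 <= h ->
    lambda d h <=
      lambda d 0 * expR (- (h ^+ 2 * (d%:R - 1) ^+ 2 / (2 * d%:R))) /\
    lambda d 0 * expR (- (h ^+ 2 * (d%:R - 1) ^+ 2 / (2 * d%:R))) <
      d%:R * expR (- (h ^+ 2 * (d%:R - 1) ^+ 2 / (2 * d%:R)))).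
Proof.
split; first split; first by move=> h; exact: lambda_gt.
- by have := @lambda_gt R d hd 0; rewrite mul0r gauss_tail0.
- move=> h h0; split; first exact: lambda_le_exp.
  by rewrite ltr_pM2r ?expR_gt0//; exact: lambda0_lt.
Qed.
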